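(* Let $G'=\{x\rightarrow y,\ y\rightarrow y\}$. For any $n\geqslant 1$, one has $$(xD_{G'})^n=\sum_{k=1}^n\sum_{\ell=k}^nA_{n,k,\ell}x^\ell y^{n-\ell}D_{G'}^k,$$ where the coefficients $A_{n,k,\ell}$ satisfy the recurrence relation $$A_{n+1,k,\ell}=\ell A_{n,k,\ell}+(n-\ell+1)A_{n,k,\ell-1}+A_{n,k-1,\ell-1},$$ with the initial conditions $A_{1,1,1}=1$ and $A_{1,k,\ell}=0$ if $(k,\ell)\neq (1,1)$. The coefficient $A_{n,k,\ell}$ counts binary $k$-forests on $[n]$ with $n-\ell$ right leaves.
   Context: Grammars: a grammar $G$ on commuting variables is a set of substitution rules $v\rightarrow f_v$; $D_G$ is the derivation (linear, Leibniz rule, killing constants) on functions (e.g. polynomials) in the variables with $D_G(v)=f_v$. For a function $w$, $wD_G$ is the operator $f\mapsto wD_G(f)$, and $(wD_G)^n$ is its $n$-fold composition; in expansions $\sum_k c_kD_G^k$ the functions $c_k$ act by multiplication. Trees: a planted binary increasing plane tree on a finite set $S$ of $m\ge1$ positive integers is a rooted plane tree with $m$ internal vertices labeled bijectively by $S$ and $m$ unlabeled leaves such that: (i) the vertex with the smallest label is the root, and it has exactly one child; (ii) every other internal vertex has exactly two ordered children, a left child and a right child (each an internal vertex or a leaf); (iii) labels increase along the path from the root to any internal vertex. A right leaf is a leaf that is the right child of its parent (a leaf that is the single child of the root is not a right leaf). A binary $k$-forest on $[n]=\{1,\dots,n\}$ is a sequence of $k$ planted binary increasing plane trees whose label sets form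 a partition of $[n]$, with root labels increasing from left to right. *)

(* Defs.v *)
From HB Require Import structures.
From mathcomp Require Import all_boot all_order all_algebra.
From mathcomp Require Import mpoly.

Set Implicit Arguments.
Unset Strict Implicit.
Unset Printing Implicit Defensive.

Import GRing.Theory.
Local Open Scope ring_scope.

(* G lists the rules v -> f_v as pairs (v, f_v).  T stands for the algebra of
   functions in the variables, with constants in K; grammar_derivation_mpoly
   below is the polynomial instance. *)
Definition grammar_derivation (K : comNzRingType) (T : comAlgType K)
    (G : seq (T * T)) (D : T -> T) : Prop :=
  [/\ linear D,
      forall f g : T, D (f * g) = D f * g + f * D g,
      forall c : K, D c%:A = 0
    & {in G, forall r, D r.1 = r.2}].

Definition mulD (T : nzRingType) (w : T) (D : T -> T) : T -> T :=
  fun f => w * D f.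

Lemma grammar_derivation_mpoly (K : comNzRingType) (m : nat)
    (rhs : 'I_m -> {mpoly K[m]}) :
  grammar_derivation [seq ('X_i : {mpoly K[m]}, rhs i) | i <- enum 'I_m]
    (fun p => \sum_(i < m) rhs i * p^`M(i)).
Proof.
split.
- move=> a p q; rewrite scaler_sumr -big_split /=; apply: eq_bigr => i _.
  by rewrite linearP /= mulrDr scalerAr.
- move=> p q; rewrite mulr_suml mulr_sumr -big_split /=.
  apply: eq_bigr => i _.
  by rewrite mderivM mulrDr; congr (_ + _); [exact: mulrA | exact: mulrCA].
- move=> c; apply: big1 => i _.
  by rewrite linearZ /= -mpolyC1 mderivC scaler0 mulr0.
- move=> _ /mapP [j _ ->] /=.
  rewrite (bigD1 j) //= big1 => [|i nij].
    have -> : 'X_j^`M(j) = 1 :> {mpoly K[m]}.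
      rewrite mderivX mnm1E eqxx scale1r -mpolyX0; congr mpolyX.
      by apply/mnmP => k; rewrite mnmBE mnm0E subnn.
    by rewrite addr0 mulr1.
  by rewrite mderivX mnm1E eq_sym (negPf nij) scale0r mulr0.
Qed.

(* The part of a planted tree hanging below its root: a leaf, or an internal
   vertex with its label, left child and right child. *)
Inductive btree := BLeaf | BNode of nat & btree & btree.

Fixpoint btree_encode (t : btree) : GenTree.tree nat :=
  match t with
  | BLeaf => GenTree.Node 0 [::]
  | BNode a l r =>
      GenTree.Node 1 [:: GenTree.Leaf a; btree_encode l; btree_encode r]
  end.

Fixpoint btree_decode (t : GenTree.tree nat) : btree :=
  match t with
  | GenTree.Node _ [:: GenTree.Leaf a; l; r] =>
      BNode a (btree_decode l) (btree_decode r)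
  | _ => BLeaf
  end.

Lemma btree_encodeK : cancel btree_encode btree_decode.
Proof. by elim=> //= a l -> r ->. Qed.

HB.instance Definition _ := Countable.copy btree (can_type btree_encodeK).

(* A planted tree: the label of the root and its only child.  With m internal
   vertices it always has m leaves. *)
Definition ptree : Type := (nat * btree)%type.

Fixpoint btree_labels (t : btree) : seq nat :=
  if t is BNode a l r then a :: btree_labels l ++ btree_labels r else [::].

Definition ptree_labels (t : ptree) : seq nat := t.1 :: btree_labels t.2.

Fixpoint increasing_from (a : nat) (t : btree) : bool :=
  if t is BNode b l r
  then [&& (a < b)%N, increasing_from b l & increasing_from b r] else true.

Definition increasing_ptree (t : ptree) : bool :=
  [&& uniq (ptree_labels t),
      all (leq t.1) (ptree_labels t)
    & increasing_from t.1 t.2].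

Fixpoint btree_right_leaves (t : btree) : nat :=
  if t is BNode _ l r
  then (btree_right_leaves l + btree_right_leaves r + (r == BLeaf))%N
  else 0%N.

(* The child of the root is not a right child. *)
Definition ptree_right_leaves (t : ptree) : nat := btree_right_leaves t.2.

Definition forest : Type := seq ptree.

(* As each tree has distinct labels and at least one label, perm_eq says that
   the label sets form a partition of {1, ..., n}. *)
Definition binary_forest (k n : nat) (F : forest) : bool :=
  [&& size F == k,
      all increasing_ptree F,
      perm_eq (flatten (map ptree_labels F)) (iota 1 n)
    & sorted ltn (map fst F)].

Definition right_leaves (F : forest) : nat :=
  sumn (map ptree_right_leaves F).

Definition count_is (T : eqType) (P : pred T) (c : int) : Prop :=
  exists s : seq T, [/\ uniq s, s =i P & (size s)%:Z = c].

(* Main.v *)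
Require Import Defs.
From mathcomp Require Import all_boot all_order all_algebra.
From mathcomp Require Import zify.

(** The proof is the grammatical labelling argument.  Let a forest F on [n] with
    k trees and m right leaves have the weight x^(n-m) y^m D^k: each of its n
    leaves is labelled y if it is a right leaf and x otherwise, and each tree
    carries a factor D.  Every forest on [n+1] arises exactly once from a forest
    on [n] by inserting the label n+1, in one of three ways:
    - as a new last tree: one more leaf labelled x and one more factor D;
    - at one of the m right leaves, which becomes a vertex with two leaves: the
      number of right leaves is unchanged, and there is one more label x;
    - at one of the n-m other leaves: there is one more right leaf, and hence
      one more label y.
    The Leibniz rule, with D x = D y = y, says that applying x D to the weight of
    F gives the sum of the weights of these n+1 forests: D falls on the operator
    part, on a factor y or on a factor x.  So (x D)^n is the sum of the weights
    of all forests on [n] ([iter_mulD_forests]), and collecting equal weights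
    gives the expansion.

    The combinatorial content is one identity ([sum_forests]): it expresses the
    sum of g (number of trees, number of right leaves) over the forests on [n+1]
    by a sum over the forests on [n], for an arbitrary function g with values in
    an additive monoid.  Taking for g the weights gives the operator expansion;
    taking indicator functions gives the recurrence, for all integers k and l at
    once, because the coefficients are defined as numbers of forests.

    Forests are handled through the binary trees of which they are the right
    spines: a sequence of pairs (root label, child of the root) is a binary tree
    whose right spine carries the root labels and whose left subtrees are the
    children of the roots.  The binary forests on [n] become the increasing
    binary trees on [n], and creating a new last tree becomes the insertion at
    the end of the right spine, so that a single operation, the replacement of a
    leaf by a vertex with two leaves, covers the three cases above. *)

Set Implicit Arguments.
Unset Strict Implicit.
Unset Printing Implicit Defensive.

Import GRing.Theory.
Local Open Scope ring_scope.

(** * Forests as increasing binary trees *)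

Fixpoint comb (F : forest) : btree :=
  if F is p :: F' then BNode p.1 p.2 (comb F') else BLeaf.

Fixpoint uncomb (t : btree) : forest :=
  if t is BNode a l r then (a, l) :: uncomb r else [::].

Lemma combK : cancel comb uncomb.
Proof. by elim=> [|[a t] F /= ->]. Qed.

Lemma uncombK : cancel uncomb comb.
Proof. by elim=> //= a l _ r ->. Qed.

Lemma btree_labels_comb F :
  btree_labels (comb F) = flatten (map ptree_labels F).
Proof. by elim: F => //= p F ->. Qed.

Lemma increasing_from_all a t :
  increasing_from a t -> all (ltn a) (btree_labels t).
Proof.
elim: t a => //= b l IHl r IHr a /and3P[ab /IHl lb /IHr rb].
rewrite ab all_cat /=; apply/andP; split.
  by apply: sub_all lb => c; apply: ltn_trans.
by apply: sub_all rb => c; apply: ltn_trans.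
Qed.

(** The increase along the right spine of the binary tree is the increase of the
    root labels from left to right; the increase inside the left subtrees is that
    of each planted tree. *)
Lemma increasing_from_comb a F :
  increasing_from a (comb F) =
  path ltn a (map fst F) && all (fun p => increasing_from p.1 p.2) F.
Proof.
elim: F a => //= p F IH a; rewrite IH.
by case: ltnP => //= _; case: increasing_from; rewrite ?andbF.
Qed.

Definition increasing_tree_on (n : nat) (t : btree) : bool :=
  increasing_from 0 t && perm_eq (btree_labels t) (iota 1 n).

Lemma binary_forest_comb k n F :
  binary_forest k n F = (size F == k) && increasing_tree_on n (comb F).
Proof.
rewrite /binary_forest /increasing_tree_on btree_labels_comb.
case: (size F == k) => //=.
rewrite andbCA [RHS]andbC.
case permF: perm_eq => //=.
have uniF : uniq (flatten (map ptree_labels F)).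
  by rewrite (perm_uniq permF) iota_uniq.
(* [sorted] on the roots puts no lower bound on the first one, unlike
   [increasing_from 0]; the bound comes from the labels being in [n]. *)
have posF : all (ltn 0) (map fst F).
  apply/allP=> _ /mapP[p pF ->].
  have : p.1 \in flatten (map ptree_labels F).
    apply/flattenP; exists (ptree_labels p); first exact: map_f.
    exact: mem_head.
  by rewrite (perm_mem permF) mem_iota; case/andP.
have -> : all increasing_ptree F = all (fun p => increasing_from p.1 p.2) F.
  elim: F uniF {permF posF} => // p F IH.
  have -> : flatten (map ptree_labels (p :: F)) =
            ptree_labels p ++ flatten (map ptree_labels F) by [].
  rewrite cat_uniq => /and3P[up _ uF] /=.
  rewrite (IH uF) /increasing_ptree; congr (_ && _).
  rewrite up /= leqnn /=; case incp: increasing_from; last by rewrite andbF.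
  rewrite andbT; apply: sub_all (increasing_from_all incp) => c; exact: ltnW.
by rewrite increasing_from_comb path_min_sorted // andbC.
Qed.

(** * Insertion of the largest label *)

Fixpoint grow (a : nat) (t : btree) : seq btree :=
  if t is BNode b l r
  then [seq BNode b l' r | l' <- grow a l] ++
       [seq BNode b l r' | r' <- grow a r]
  else [:: BNode a BLeaf BLeaf].

(** Left inverse of the insertion of [a]: in an increasing tree with largest
    label [a], the vertex [a] has two leaves as children, so that cutting the whole
    subtree at [a] loses nothing else. *)
Fixpoint prune (a : nat) (t : btree) : btree :=
  if t is BNode b l r
  then if b == a then BLeaf else BNode b (prune a l) (prune a r)
  else BLeaf.

Lemma leaf_notin_grow a t : BLeaf \notin grow a t.
Proof.
case: t => [|b l r] //=.
by rewrite mem_cat negb_or; apply/andP; split; apply/negP => /mapP[].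
Qed.

Lemma perm_labels_grow a t t' :
  t' \in grow a t -> perm_eq (btree_labels t') (a :: btree_labels t).
Proof.
elim: t t' => [|b l IHl r IHr] t' /=; first by rewrite inE => /eqP->.
rewrite mem_cat => /orP[] /mapP[u /[swap] -> /= uin].
  rewrite -[a :: b :: _]/([:: a] ++ [:: b] ++ _) perm_sym perm_catCA /=.
  by rewrite perm_cons perm_sym -cat_cons perm_cat2r IHl.
rewrite -[a :: b :: _]/([:: a] ++ [:: b] ++ _) perm_sym perm_catCA /=.
rewrite perm_cons perm_sym -cat1s perm_sym perm_catCA perm_cat2l.
by rewrite perm_sym IHr.
Qed.

Lemma notin_grow a t : t \notin grow a t.
Proof.
by apply/negP => /perm_labels_grow/perm_size/= /eqP; rewrite ltn_eqF.
Qed.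

(** An insertion to the left and one to the right cannot agree: the left subtree
    would be an insertion into itself, against the number of labels. *)
Lemma grow_uniq a t : uniq (grow a t).
Proof.
elim: t => //= b l IHl r IHr.
rewrite cat_uniq !map_inj_uniq ?IHl ?IHr; try by move=> u v [].
rewrite andbT /=; apply/hasPn => _ /mapP[r' _ ->]; apply/negP.
by case/mapP => l' /[swap] -[<- _]; apply/negP; apply: notin_grow.
Qed.

Lemma prune_id a t : a \notin btree_labels t -> prune a t = t.
Proof.
elim: t => //= b l IHl r IHr; rewrite inE mem_cat !negb_or eq_sym.
by case/and3P => /negPf-> /IHl-> /IHr->.
Qed.

Lemma prune_grow a t t' :
  a \notin btree_labels t -> t' \in grow a t -> prune a t' = t.
Proof.
elim: t t' => [|b l IHl r IHr] t' /=.
  by rewrite inE => _ /eqP-> /=; rewrite eqxx.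
rewrite inE mem_cat !negb_or eq_sym => /and3P[/negPf ba al ar].
rewrite mem_cat => /orP[] /mapP[u uin ->] /=; rewrite ba.
  by rewrite (IHl u) // prune_id.
by rewrite (IHr u) // prune_id.
Qed.

Lemma increasing_from_grow a b t t' :
  (b < a)%N -> all (gtn a) (btree_labels t) -> increasing_from b t ->
  t' \in grow a t -> increasing_from b t'.
Proof.
elim: t b t' => [|c l IHl r IHr] b t' ba /=.
  by rewrite inE => _ _ /eqP-> /=; rewrite ba.
rewrite all_cat => /and3P[ca la ra] /and3P[bc cl cr].
rewrite mem_cat => /orP[] /mapP[u uin ->] /=; rewrite bc ?cl ?cr ?andbT /=.
  exact: IHl uin.
exact: IHr uin.
Qed.

(** Surjectivity of the insertion.  If [a] is the largest label, nothing can lie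
    below it, hence the vertex [a] comes from a leaf; since the labels are
    distinct, [a] lies in only one of the two subtrees of any vertex above it,
    and [prune] leaves the other one unchanged. *)
Lemma mem_grow_prune a b t :
  increasing_from b t -> all (geq a) (btree_labels t) ->
  uniq (btree_labels t) -> a \in btree_labels t ->
  increasing_from b (prune a t) /\ t \in grow a (prune a t).
Proof.
elim: t b => //= c l IHl r IHr b /and3P[bc cl cr].
rewrite all_cat cat_uniq mem_cat negb_or => /and3P[ca la ra].
case/andP=> /andP[cnl cnr] /and3P[ul lr ur].
have [c_a | c_ne_a] := eqVneq c a.
  rewrite {}c_a in bc cl cr *.
  have leaf t :
      increasing_from a t -> all (geq a) (btree_labels t) -> t = BLeaf.
    case: t => //= d u v /and3P[ad _ _] /andP[da _].
    by rewrite ltnNge da in ad.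
  by rewrite (leaf l) // (leaf r) //= => _; rewrite mem_head.
rewrite /= inE [a == c]eq_sym (negPf c_ne_a) mem_cat /= => /orP[al | ar].
  have anr : a \notin btree_labels r.
    by apply: contra lr => ar; apply/hasP; exists a.
  have [incl inl] := IHl c cl la ul al.
  by rewrite (prune_id anr) bc incl cr mem_cat map_f.
have anl : a \notin btree_labels l.
  by apply: contra lr => al; apply/hasP; exists a.
have [incr inr] := IHr c cr ra ur ar.
by rewrite (prune_id anl) bc incr cl mem_cat map_f // orbT.
Qed.

Fixpoint increasing_trees (n : nat) : seq btree :=
  if n is m.+1 then flatten [seq grow n t | t <- increasing_trees m]
  else [:: BLeaf].

Lemma mem_increasing_trees n t :
  (t \in increasing_trees n) = increasing_tree_on n t.
Proof.
rewrite /increasing_tree_on.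
elim: n t => [|n IH] t.
  by rewrite inE; case: t => //= a l r; apply/esym/negP => /andP[_ /perm_size].
have iotaSE : perm_eq (iota 1 n.+1) (n.+1 :: iota 1 n).
  by rewrite -(addn1 n) iotaD perm_catC /= add1n addn1.
rewrite [increasing_trees _]/=.
apply/flattenP/andP => [[_ /mapP[u uin ->] tu] | [inct permt]].
  move: uin; rewrite IH => /andP[incu permu]; split.
    apply: increasing_from_grow tu => //; rewrite (perm_all _ permu).
    by apply/allP => i; rewrite mem_iota /= add1n => /andP[].
  apply: perm_trans (perm_labels_grow tu) _.
  by rewrite perm_sym; apply: perm_trans iotaSE _; rewrite perm_cons perm_sym.
have labt : btree_labels t =i iota 1 n.+1 by exact: perm_mem.
have [||| incp tin] := mem_grow_prune (a := n.+1) inct.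
- by apply/allP => i; rewrite labt mem_iota /= add1n => /andP[].
- by rewrite (perm_uniq permt) iota_uniq.
- by rewrite labt mem_iota /= add1n.
exists (grow n.+1 (prune n.+1 t)) => //; apply: map_f.
rewrite IH incp /= -(perm_cons n.+1) perm_sym.
apply: perm_trans (perm_labels_grow tin); rewrite perm_sym.
exact: perm_trans permt iotaSE.
Qed.

(** Insertions into different trees are different because [prune] recovers the
    tree, and insertions into the same tree are different by [grow_uniq]. *)
Lemma increasing_trees_uniq n : uniq (increasing_trees n).
Proof.
elim: n => //= n IH.
have : {in increasing_trees n, forall t, n.+1 \notin btree_labels t}.
  move=> t; rewrite mem_increasing_trees => /andP[_ permt].
  by rewrite (perm_mem permt) mem_iota add1n ltnn andbF.
elim: (increasing_trees n) IH => //= t s IH /andP[tns us] fresh.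
rewrite cat_uniq grow_uniq IH //= ?andbT; last first.
  by move=> u us'; apply: fresh; rewrite inE us' orbT.
apply/hasPn => u /flattenP[_ /mapP[v vs ->] uv]; apply/negP => ut.
move: tns; rewrite -(prune_grow (fresh t (mem_head _ _)) ut).
by rewrite (prune_grow (fresh v _) uv) ?vs // inE vs orbT.
Qed.

Definition forests (n : nat) : seq forest := map uncomb (increasing_trees n).

Lemma forests_uniq n : uniq (forests n).
Proof.
by rewrite map_inj_uniq ?increasing_trees_uniq //; exact: can_inj uncombK.
Qed.

Lemma mem_forests k n F :
  binary_forest k n F = (size F == k) && (F \in forests n).
Proof.
rewrite binary_forest_comb -mem_increasing_trees; congr (_ && _).
by rewrite -[F in RHS]combK mem_map //; exact: can_inj uncombK.
Qed.

(** * Effect of an insertion on the statistics *)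

Lemma btree_right_leaves_le t :
  (btree_right_leaves t <= size (btree_labels t))%N.
Proof.
elim: t => //= b l IHl r IHr; rewrite size_cat.
by case: (r == BLeaf); lia.
Qed.

Lemma right_leaves_cons p F :
  right_leaves (p :: F) = (btree_right_leaves p.2 + right_leaves F)%N.
Proof. by []. Qed.

Lemma size_right_leaves_le t :
  (size (uncomb t) + right_leaves (uncomb t) <= size (btree_labels t))%N.
Proof.
elim: t => //= b l _ r IHr; rewrite size_cat right_leaves_cons /=.
by have := btree_right_leaves_le l; lia.
Qed.

(** A binary tree with N vertices has N+1 leaves.  Insertion at a right leaf
    destroys a right leaf and creates one; insertion at any other leaf creates
    one. *)
Lemma sum_grow_btree (V : nmodType) (g : nat -> V) a t :
  \sum_(t' <- grow a t) g (btree_right_leaves t') =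
  g (btree_right_leaves t) *+ btree_right_leaves t +
  g (btree_right_leaves t).+1
    *+ ((size (btree_labels t)).+1 - btree_right_leaves t).
Proof.
elim: t g => [|b l IHl r IHr] g /=; first by rewrite big_seq1 /= mulr0n add0r.
rewrite big_cat !big_map /= size_cat.
rewrite (IHl (fun i => g (i + _ + _)%N)).
have Hl := btree_right_leaves_le l.
have Hr := btree_right_leaves_le r.
(* A right child that is a leaf is itself a right leaf: inserting there replaces
   the indicator in the parent by the right leaf of the new vertex.  Otherwise
   the right child stays a vertex and the indicator stays 0. *)
have [r_leaf | r_node] := eqVneq r BLeaf.
  by rewrite r_leaf big_seq1 /= !addn0 !addn1 addrAC -mulrSr subSS.
have -> : \sum_(r' <- grow a r)
    g (btree_right_leaves l + btree_right_leaves r' + (r' == BLeaf))%N =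
  \sum_(r' <- grow a r) g (btree_right_leaves l + btree_right_leaves r')%N.
  apply: eq_big_seq => r'; case: eqP => [-> | _]; last by rewrite addn0.
  by rewrite (negPf (leaf_notin_grow a r)).
rewrite (IHr (fun i => g (_ + i)%N)) !addn0 addrACA addSn !addnS -!mulrnDr.
by congr (_ + g _ *+ _); lia.
Qed.

(** The leaf at the end of the right spine stands for no leaf of the forest: the
    insertion there creates a tree, without a new right leaf, whence the first
    summand.  The other leaves are the N leaves of the planted trees, and an
    insertion at one of these keeps the number of trees. *)
Lemma sum_grow (V : nmodType) (g : nat -> nat -> V) a t :
  let k := size (uncomb t) in let m := right_leaves (uncomb t) in
  \sum_(t' <- grow a t) g (size (uncomb t')) (right_leaves (uncomb t')) =
  g k.+1 m + g k m *+ m + g k m.+1 *+ (size (btree_labels t) - m).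
Proof.
elim: t g => [|b l _ r IHr] g /=; first by rewrite big_seq1 /= !mulr0n !addr0.
rewrite big_cat !big_map /= right_leaves_cons /=.
under eq_bigr do rewrite right_leaves_cons /=.
under [X in _ + X]eq_bigr do rewrite right_leaves_cons /=.
rewrite (sum_grow_btree (fun i => g _ (i + _)%N)).
rewrite (IHr (fun k m => g k.+1 (_ + m)%N)).
have Hl := btree_right_leaves_le l; have Hr := size_right_leaves_le r.
rewrite size_cat addSn !addnS addrACA -mulrnDr [X in X + _ = _]addrCA -mulrnDr.
by congr (_ + _ + g _ _ *+ _); lia.
Qed.

(** The common source of the recurrence and of the operator expansion: the three
    ways of inserting n+1, for an arbitrary function of the two statistics. *)
Lemma sum_forests (V : nmodType) (g : nat -> nat -> V) n :
  \sum_(F <- forests n.+1) g (size F) (right_leaves F) =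
  \sum_(F <- forests n)
    (g (size F).+1 (right_leaves F)
     + g (size F) (right_leaves F) *+ right_leaves F
     + g (size F) (right_leaves F).+1 *+ (n - right_leaves F)).
Proof.
rewrite !big_map /= big_flatten /= big_map; apply: eq_big_seq => t.
rewrite mem_increasing_trees => /andP[_ /perm_size].
by rewrite size_iota sum_grow => ->.
Qed.

Lemma forests_bounds n F : (0 < n)%N -> F \in forests n ->
  (0 < size F)%N /\ (size F + right_leaves F <= n)%N.
Proof.
move=> n_gt0 /mapP[t]; rewrite mem_increasing_trees => /andP[_ /perm_size].
rewrite size_iota => sz ->; split; last by rewrite -sz size_right_leaves_le.
by case: t sz => //= n0; rewrite -n0 in n_gt0.
Qed.

(** * The coefficients and their recurrence *)

Definition forest_number (n : nat) (k l : int) : int :=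
  (count (fun F => ((size F)%:Z == k) && ((right_leaves F)%:Z == n%:Z - l))
     (forests n))%:Z.

Lemma forest_numberE n k l :
  forest_number n k l =
  \sum_(F <- forests n)
    (((size F)%:Z == k) && ((right_leaves F)%:Z == n%:Z - l))%:R.
Proof.
rewrite /forest_number -sum1_count big_mkcond -natz natr_sum.
by apply: eq_bigr => F _; case: ifP.
Qed.

(** An instance of [sum_forests], for an indicator function.  A forest with m
    right leaves contributes to its second summand only if m = n - l + 1 and to
    its third one only if n - m = l; so the multiplicities m and n - m there can
    be replaced by the coefficients n - l + 1 and l of the recurrence. *)
Lemma forest_number_rec n k l : (0 < n)%N ->
  forest_number n.+1 k l =
  l * forest_number n k l + (n%:Z - l + 1) * forest_number n k (l - 1)
  + forest_number n (k - 1) (l - 1).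
Proof.
move=> n_gt0; rewrite !forest_numberE.
rewrite (sum_forests (fun s m => ((s%:Z == k) && (m%:Z == n.+1%:Z - l))%:R)).
rewrite !mulr_sumr -!big_split /=.
apply: eq_big_seq => F /(forests_bounds n_gt0).
move: (size F) (right_leaves F) => s m [_ le_n].
rewrite -!(mulr_natr (_%:R)).
have -> : (s.+1%:Z == k) = (s%:Z == k - 1) by lia.
have -> : (m.+1%:Z == n.+1%:Z - l) = (m%:Z == n%:Z - l) by lia.
have -> : (m%:Z == n.+1%:Z - l) = (m%:Z == n%:Z - (l - 1)) by lia.
case: (s%:Z =P k) => Hs; case: (m%:Z =P n%:Z - l) => Hm;
  case: (s%:Z =P k - 1) => Hs'; case: (m%:Z =P n%:Z - (l - 1)) => Hm' /=; lia.
Qed.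

(** * The operator expansion *)

Section Operator.

Variables (K : comNzRingType) (T : comAlgType K) (x y : T) (D : T -> T).
Hypothesis gramD : grammar_derivation [:: (x, y); (y, y)] D.

Let DD f g : D (f + g) = D f + D g.
Proof. by case: gramD => linD _ _ _; have := linD 1 f g; rewrite !scale1r. Qed.

Let D0 : D 0 = 0.
Proof. by apply: (addrI (D 0)); rewrite -DD !addr0. Qed.

Let DM f g : D (f * g) = D f * g + f * D g.
Proof. by case: gramD. Qed.

Let D1 : D 1 = 0.
Proof. by case: gramD => _ _ Dc _; rewrite -(Dc 1) scale1r. Qed.

Let Dx : D x = y.
Proof. by case: gramD => _ _ _ /(_ (x, y)); apply; rewrite inE eqxx. Qed.

Let Dy : D y = y.
Proof. by case: gramD => _ _ _ /(_ (y, y)); apply; rewrite !inE eqxx orbT. Qed.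

(** The factor [x] in front avoids the exponent l - 1 of D (x^l). *)
Lemma mulD_expx l : x * D (x ^+ l) = x ^+ l * y *+ l.
Proof.
elim: l => [|l IH]; first by rewrite expr0 D1 mulr0 mulr0n.
rewrite exprS DM Dx mulrDr IH mulrSr addrC; congr (_ + _).
  by rewrite mulrnAr mulrA.
by rewrite -mulrA [y * _]mulrC.
Qed.

Lemma D_expy m : D (y ^+ m) = y ^+ m *+ m.
Proof.
elim: m => [|m IH]; first by rewrite expr0 D1 mulr0n.
by rewrite exprS DM Dy IH mulrS mulrnAr.
Qed.

(** The three summands are the three ways of inserting a label: [D] reaches the
    operator part, one of the m factors y, or one of the l factors x. *)
Lemma mulD_monomial l m h :
  mulD x D (x ^+ l * y ^+ m * h) =
  x ^+ l.+1 * y ^+ m * D h + x ^+ l.+1 * y ^+ m * h *+ m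
  + x ^+ l * y ^+ m.+1 * h *+ l.
Proof.
rewrite /mulD !DM D_expy mulrDr mulrDl mulrDr.
have -> : x * (D (x ^+ l) * y ^+ m * h) = x ^+ l * y ^+ m.+1 * h *+ l.
  by rewrite !mulrA mulD_expx !mulrnAl exprS !mulrA.
by rewrite !(mulrnAr, mulrnAl) !mulrA -exprS addrC [X in _ + X]addrC addrA.
Qed.

Lemma iter_mulD_forests n f :
  iter n (mulD x D) f =
  \sum_(F <- forests n)
    x ^+ (n - right_leaves F) * y ^+ right_leaves F * iter (size F) D f.
Proof.
case: n => [|n]; first by rewrite big_seq1 /= !expr0 !mul1r.
elim: n => [|n IH]; first by rewrite big_seq1 /= expr1 expr0 mulr1.
rewrite iterS {}IH.
rewrite [RHS](sum_forests
  (fun s m => x ^+ (n.+2 - m) * y ^+ m * iter s D f)).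
rewrite (big_morph (mulD x D) (id1 := 0) (op1 := +%R)); first last.
- by rewrite /mulD D0 mulr0.
- by move=> g h; rewrite /mulD DD mulrDr.
apply: eq_big_seq => F /(forests_bounds (ltn0Sn _))[_ le_n].
have le_m : (right_leaves F <= n.+1)%N by lia.
by rewrite mulD_monomial subSS [(n.+2 - _)%N]subSn.
Qed.

End Operator.

Lemma sum_nat_delta (V : nmodType) (a b i : nat) (g : nat -> V) :
  (a <= i < b)%N -> \sum_(a <= j < b) g j *+ (i == j) = g i.
Proof.
move=> Hi; rewrite (bigD1_seq i) ?mem_index_iota ?iota_uniq //= eqxx mulr1n.
by rewrite big1 ?addr0 // => j; rewrite eq_sym => /negPf->.
Qed.

Lemma iter_mulD_expansion (K : comNzRingType) (T : comAlgType K) (x y : T)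
    (D : T -> T) n f : (0 < n)%N ->
  grammar_derivation [:: (x, y); (y, y)] D ->
  iter n (mulD x D) f =
    \sum_(1 <= k < n.+1) \sum_(k <= l < n.+1)
      (forest_number n k%:Z l%:Z)%:~R * x ^+ l * y ^+ (n - l) * iter k D f.
Proof.
move=> n_gt0 gramD; rewrite (iter_mulD_forests gramD).
(* The contribution of F to the coefficient at (k, l): its weight if (k, l) is
   (number of trees, number of leaves that are not right leaves), else 0. *)
pose c (F : forest) k l : T :=
  x ^+ l * y ^+ (n - l) * iter k D f
    *+ (n - right_leaves F == l)%N *+ (size F == k).
transitivity
  (\sum_(1 <= k < n.+1) \sum_(k <= l < n.+1) \sum_(F <- forests n) c F k l).
  under [RHS]eq_bigr do rewrite exchange_big.
  rewrite [RHS]exchange_big /c; apply: eq_big_seq => F /(forests_bounds n_gt0).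
  move: (size F) (right_leaves F) => s m [s_gt0 le_n] /=.
  under eq_bigr do rewrite sumrMnl.
  (* The delta selects an index in the range of summation because the number of
     trees is positive and at most the number of leaves that are not right. *)
  rewrite sum_nat_delta; last by lia.
  rewrite sum_nat_delta; last by lia.
  by rewrite subKn //; lia.
apply: eq_big_nat => k Hk; apply: eq_big_nat => l Hl.
rewrite /forest_number -pmulrn -!mulrA mulr_natl -sum1_count.
rewrite -sumrMnr [RHS]big_mkcond.
apply: eq_big_seq => F /(forests_bounds n_gt0)[_ le_n].
rewrite /c -mulrnA mulnb mulrA eqz_nat andbC.
have -> :
  (n - right_leaves F == l)%N = ((right_leaves F)%:Z == n%:Z - l%:Z) by lia.
by case: ifP.
Qed.

Theorem theorem5 :
  exists A : nat -> int -> int -> int,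
    [/\ forall n : nat, (1 <= n)%N ->
          forall (K : comNzRingType) (T : comAlgType K) (x y : T) (D : T -> T),
            grammar_derivation [:: (x, y); (y, y)] D ->
          forall f : T,
            iter n (mulD x D) f =
              \sum_(1 <= k < n.+1) \sum_(k <= l < n.+1)
                (A n k%:Z l%:Z)%:~R * x ^+ l * y ^+ (n - l) * iter k D f,
        forall n : nat, (1 <= n)%N -> forall k l : int,
          A n.+1 k l =
            l * A n k l + (n%:Z - l + 1) * A n k (l - 1) + A n (k - 1) (l - 1),
        A 1%N 1 1 = 1,
        forall k l : int, (k, l) <> (1, 1) -> A 1%N k l = 0
      & forall n : nat, (1 <= n)%N -> forall k l : nat,
          count_is (fun F : forest =>
              binary_forest k n F && ((right_leaves F)%:Z == n%:Z - l%:Z))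
            (A n k%:Z l%:Z)].
Proof.
exists forest_number; split.
- by move=> n n_gt0 K T x y D gramD f; exact: iter_mulD_expansion.
- by move=> n n_gt0 k l; exact: forest_number_rec.
- by [].
- move=> k l kl; rewrite /forest_number /= addn0 /right_leaves /=.
  case: eqP => //= k1; case: eqP => //= l1; case: kl.
  move: l1; rewrite /ptree_right_leaves /= -k1 => l1; congr pair; lia.
- move=> n n_gt0 k l.
  exists [seq F <- forests n |
    ((size F)%:Z == k%:Z) && ((right_leaves F)%:Z == n%:Z - l%:Z)]; split.
  + exact/filter_uniq/forests_uniq.
  + move=> F; rewrite mem_filter eqz_nat /in_mem /= mem_forests.
    by rewrite andbAC.
  + by rewrite size_filter.
Qed.
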